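(* Let $Q\ge2$ and $D\ge2$ be integers, let $R_n$ be the cost of the symmetrical $Q$-ary splitting algorithm with threshold $D$, and let $\mathcal{R}(x)$, $x\geq 0$, be the Poisson transform of $(R_n)$ (see context). Let $\mathcal{N}$ be a Poisson process with intensity $1$ on $\mathbb{R}_+$ and $\mathcal{M}$ a Poisson process with intensity $1$ (with respect to Lebesgue measure) on $[0,1]\times\mathbb{R}_+$. Then, for every $x\geq 0$, $$\mathcal{R}(x)\stackrel{\text{dist.}}{=}\mathcal{R}_1(x)\stackrel{\text{def.}}{=}1+Q\sum_{p\ge0}\sum_{k=0}^{Q^p-1}\phi_{\mathcal{N}}\big(xk/Q^p,\,x(k+1)/Q^p\big),$$ where, for $0\le a\le b$, $\phi_{\mathcal{N}}(a,b)=1$ if $\mathcal{N}(]a,b])\ge D$ and $\phi_{\mathcal{N}}(a,b)=0$ otherwise; and $$\mathcal{R}(x)\stackrel{\text{dist.}}{=}\mathcal{R}_2(x)\stackrel{\text{def.}}{=}1+Q\sum_{p\ge0}\sum_{k=0}^{Q^p-1}\mathbb{1}_{\{\mathcal{M}(]k/Q^p,(k+1)/Q^p]\times[0,x])\ge D\}}.$$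
   Context: Symmetrical $Q$-ary splitting algorithm with threshold $D$: start with a set of $n$ items at the root of a tree. A node whose set has fewer than $D$ items is a leaf. A node with $m\ge D$ items has exactly $Q$ children, and each of the $m$ items is sent, independently of everything else, to one of the $Q$ children chosen uniformly at random; the procedure is then applied to each child. The cost $R_n$ is the total number of nodes of the resulting tree (so $R_n=1$ for $n<D$). Poisson transform: $\mathcal{R}(x)$ denotes a random variable with the distribution of $R_{P_x}$, where $P_x$ is a Poisson random variable with parameter $x$ independent of $(R_n)$; i.e. the number of nodes of the tree when the number of initial items is Poisson with parameter $x$. For a point process, $\mathcal{N}(A)$ (resp. $\mathcal{M}(A)$) is the number of its points in $A$; $]a,b]$ is the half-open interval $(a,b]$. *)

(* Defs.v *)
From HB Require Import structures.
From mathcomp Require Import all_boot all_order all_algebra.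
From mathcomp Require Import finmap.
From mathcomp Require Import all_classical all_reals all_analysis measurable_realfun.

Set Implicit Arguments.
Unset Strict Implicit.
Unset Printing Implicit Defensive.

Import Order.TTheory GRing.Theory Num.Theory.

Local Open Scope classical_set_scope.
Local Open Scope ring_scope.

Section probability_notions.
Context {d : measure_display} {T : measurableType d} {R : realType}.
Variable P : probability T R.
Local Open Scope ereal_scope.

(* [G] is the sigma-algebra of the state space [T']. *)
Definition mutually_independent {T' : Type} (G : set (set T'))
    {I : choiceType} (X : I -> T -> T') : Prop :=
  forall (J : {fset I}) (B : I -> set T'),
    (forall i, i \in J -> G (B i)) ->
    P (\bigcap_(i in [set` J]) (X i @^-1` B i)) =
    \prod_(i <- J) P (X i @^-1` B i).

Definition independent_of_sequence {d1 d2 : measure_display}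
    {T1 : measurableType d1} {T2 : measurableType d2}
    (X : T -> T1) (Y : nat -> T -> T2) : Prop :=
  forall A B : set T,
    preimage_set_system setT X measurable A ->
    <<s \bigcup_n preimage_set_system setT (Y n) measurable >> B ->
    P (A `&` B) = P A * P B.

End probability_notions.

(* [poisson_prob] ignores its second argument. At rate 0, unlike [poisson_pmf],
   it is the Dirac mass at 0. *)
Definition poisson_law {R : realType} (r : R) : set nat -> \bar R :=
  poisson_prob r 0%N.

Section equality_in_distribution.
Context {d1 d2 d' : measure_display} {T1 : measurableType d1}
  {T2 : measurableType d2} {T' : measurableType d'} {R : realType}.

Definition eq_dist (P1 : probability T1 R) (P2 : probability T2 R)
    (X1 : T1 -> T') (X2 : T2 -> T') : Prop :=
  [/\ measurable_fun setT X1, measurable_fun setT X2 &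
      forall A : set T', measurable A ->
        pushforward P1 X1 A = pushforward P2 X2 A].

End equality_in_distribution.

Section point_processes.
Context {d d' : measure_display} {T : measurableType d} {S : measurableType d'}
  {R : realType}.
Local Open Scope ereal_scope.

(* [measurable_kernel] says that each [N A] is an extended-real random variable.
   A point process is encoded by its random counting measure: [N w A] is the
   number of points in [A], with multiplicity, of the realization [w]. *)
Definition point_process (N : R.-ker T ~> S) : Prop :=
  forall w (A : set S), measurable A ->
    N w A = +oo \/ exists k : nat, N w A = k%:R%:E.

(* [mu] is the intensity measure. *)
Definition poisson_process (P : probability T R) (mu : set S -> \bar R)
    (N : R.-ker T ~> S) : Prop :=
  [/\ point_process N,
      forall (A : set S) (k : nat), measurable A -> mu A < +oo ->
        P [set w | N w A = k%:R%:E] = poisson_law (fine (mu A)) [set k],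
      forall A : set S, measurable A -> mu A = +oo ->
        P [set w | N w A = +oo] = 1 &
      forall (n : nat) (A : 'I_n -> set S), (forall i, measurable (A i)) ->
        trivIset setT A ->
        mutually_independent P (measurable : set (set (\bar R)))
          (fun i w => N w (A i))].

End point_processes.

Section splitting_tree.
Variables Q D : nat.

(* Nodes are addressed by words over ['I_Q], read from the node up to the root:
   [[::]] is the root and [q :: v] is the [q]-th child of [v]. [c v i] is the
   child of [v] to which item [i] is sent if it reaches [v]. *)
Fixpoint items (c : seq 'I_Q -> nat -> 'I_Q) (n : nat) (v : seq 'I_Q) :
    seq nat :=
  if v is q :: u then [seq i <- items c n u | c u i == q] else iota 0 n.

Fixpoint is_node (c : seq 'I_Q -> nat -> 'I_Q) (n : nat) (v : seq 'I_Q) :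
    bool :=
  if v is q :: u then is_node c n u && (D <= size (items c n u))%N else true.

(* [+oo] if the tree is infinite, a null event for independent uniform choices
   when [2 <= Q] and [2 <= D]. *)
Definition nb_nodes (R : realType) (c : seq 'I_Q -> nat -> 'I_Q) (n : nat) :
    \bar R :=
  counting [set v | is_node c n v].

End splitting_tree.

Section splitting_algorithm.
Context {d : measure_display} {T : measurableType d}.
Variable R : realType.
Variables (P : probability T R) (Q D : nat).

(* One choice for every (node, item) pair, including pairs where the item does
   not reach the node; those choices do not affect the tree. *)
Definition uniform_choices (c : seq 'I_Q -> nat -> T -> 'I_Q) : Prop :=
  [/\ forall v i q, measurable (c v i @^-1` [set q]),
      forall v i q, P (c v i @^-1` [set q]) = (Q%:R^-1)%:E &
      mutually_independent P [set: set 'I_Q]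
        (fun vi : seq 'I_Q * nat => c vi.1 vi.2)].

Definition cost (c : seq 'I_Q -> nat -> T -> 'I_Q) (n : nat) (w : T) : \bar R :=
  nb_nodes D R (fun v i => c v i w) n.

Definition poisson_transform (c : seq 'I_Q -> nat -> T -> 'I_Q)
    (X : T -> nat) (w : T) : \bar R :=
  cost c (X w) w.

End splitting_algorithm.

Section poisson_representations.
Context {R : realType}.
Variables Q D : nat.
Local Open Scope ereal_scope.

Definition lebesgue_Rplus : set R -> \bar R :=
  mrestr (@lebesgue_measure R) (measurable_itv `[0%R, +oo[).

Definition lebesgue_strip : set (R * R)%type -> \bar R :=
  mrestr (@lebesgue_measure R \x @lebesgue_measure R)
    (measurableX (measurable_itv `[0%R, 1%R])
       (measurable_itv `[0%R, +oo[)).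

Definition phi (nu : set R -> \bar R) (a b : R) : \bar R :=
  if D%:R%:E <= nu `]a, b]%classic then 1 else 0.

Definition R1 {d : measure_display} {T : measurableType d}
    (N : R.-ker T ~> R) (x : R) (w : T) : \bar R :=
  1 + Q%:R%:E * \sum_(0 <= p <oo) \sum_(k < (Q ^ p)%N)
    phi (N w) (x * k%:R / Q%:R ^+ p)%R (x * k.+1%:R / Q%:R ^+ p)%R.

Definition R2 {d : measure_display} {T : measurableType d}
    (M : R.-ker T ~> (R * R)%type) (x : R) (w : T) : \bar R :=
  1 + Q%:R%:E * \sum_(0 <= p <oo) \sum_(k < (Q ^ p)%N)
    (if D%:R%:E <= M w (`](k%:R / Q%:R ^+ p)%R, (k.+1%:R / Q%:R ^+ p)%R]
                          `*` `[0%R, x])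
     then 1 else 0).

End poisson_representations.

(* Main.v *)
(* Address the nodes of the infinite Q-ary tree by words, and let z v be the
   number of items that reach v. The ancestors of v hold at least as many items
   as v, so the tree has 1 + Q * #{v | D <= z v} nodes, which is the common form of the cost and of
   the two point-process sums; for the latter, z v is the number of points in
   the cell coded by v. In both models z is additive along the tree, so the
   nodes up to depth p only depend on the values of z at depth p.
   For n items these are the occupation counts of n independent uniform choices
   among Q^p cells; for a Poisson process they are independent Poisson variables
   of mean x / Q^p, which conditionally on having sum n have the same law.
   Hence, for each n, the law of the tree truncated at depth p given n items is
   the same in both models. Let p tend to infinity by monotone continuity, then
   sum over n; the rays ]t, +oo] determine the laws. *)
Require Import Defs.
From mathcomp Require Import all_boot all_order all_algebra finmap.
From mathcomp Require Import all_classical all_reals all_analysis measurable_realfun.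
From mathcomp Require Import ring.

Set Implicit Arguments.
Unset Strict Implicit.
Unset Printing Implicit Defensive.

Import Order.TTheory GRing.Theory Num.Theory.

Local Open Scope classical_set_scope.
Local Open Scope ring_scope.

(** * Occupation counts and the Poisson law *)

Lemma big_tuple_cons (A : Type) (idx : A) (op : Monoid.com_law idx)
    (V : finType) (n : nat) (F : seq V -> A) :
  \big[op/idx]_(t : n.+1.-tuple V) F t =
  \big[op/idx]_(t : n.-tuple V) \big[op/idx]_(a : V) F (a :: t).
Proof.
rewrite pair_big /= (reindex (fun p : n.-tuple V * V =>
  [tuple of p.2 :: p.1])) //.
exists (fun t : n.+1.-tuple V => (behead_tuple t, thead t)) => [[t a] _|t _] /=.
  by congr (_, _); apply: val_inj.
by apply: val_inj => /=; case/tupleP: t.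
Qed.

Definition counts {V : finType} (s : seq V) : {ffun V -> nat} :=
  [ffun v => count_mem v s].

Lemma sum_counts (V : finType) (s : seq V) : (\sum_v counts s v = size s)%N.
Proof.
under eq_bigr do rewrite ffunE -sum1_count big_mkcond.
rewrite exchange_big -sum1_size; apply: eq_bigr => a _.
by rewrite -big_mkcond (big_pred1 a)// => v; rewrite /= eq_sym.
Qed.

(** The multinomial coefficient, kept in the naturals by multiplying out the factorials. Induction
    on the first letter [a]: removing it lowers [m a] by one, and the factors [m a] that this
    produces add up to [n.+1]. *)
Lemma sum_tuple_counts (V : finType) (n : nat) (m : {ffun V -> nat}) :
  (\sum_v m v = n)%N ->
  ((\sum_(W : n.-tuple V) (counts W == m)) * \prod_v (m v)`! = n`!)%N.
Proof.
elim: n m => [|n IH] m sm.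
  have m0 v : m v = 0%N.
    by move/eqP: sm; rewrite sum_nat_eq0 => /forallP/(_ v)/eqP.
  rewrite [X in (_ * X)%N]big1 ?muln1; last by move=> v _; rewrite m0.
  rewrite (eq_bigr (fun=> 1%N)) ?sum1_card ?card_tuple// => W _.
  rewrite tuple0 (_ : _ == _)//; apply/eqP/ffunP => v.
  by rewrite ffunE m0.
rewrite (@big_tuple_cons _ _ addn _ _ (fun W => nat_of_bool (counts W == m))).
rewrite exchange_big big_distrl /=.
rewrite factS -sm big_distrl /=; apply: eq_bigr => a _.
have [ma0|ma0] := posnP (m a).
  rewrite ma0 mul0n big1 ?mul0n// => W _; case: eqP => // /ffunP/(_ a).
  by rewrite ffunE/= eqxx ma0.
have [m' m'E] : exists m' : {ffun V -> nat}, forall v, m v =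
  (m' v + (v == a))%N.
  exists [ffun v => m v - (v == a)]%N => v.
  by rewrite ffunE subnK//; case: eqP => // ->.
have sm' : (\sum_v m' v = n)%N.
  apply: succn_inj; rewrite -sm; under [RHS]eq_bigr do rewrite m'E.
  rewrite big_split/= [X in (_ + X)%N](bigD1 a)//= eqxx.
  by rewrite [X in (true + X)%N]big1 ?addn1// => v /negbTE ->.
rewrite -(IH _ sm') mulnCA; congr (_ * _)%N.
  apply: eq_bigr => W _; congr nat_of_bool; apply/eqP/eqP => /ffunP cW;
    apply/ffunP => v.
    by move: (cW v); rewrite m'E !ffunE /= eq_sym addnC => /addIn.
  by rewrite m'E -cW !ffunE/= addnC eq_sym.
rewrite (bigD1 a)//= [in RHS](bigD1 a)//= mulnA; congr (_ * _)%N.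
  by rewrite m'E eqxx addn1 factS.
by apply: eq_bigr => v /negbTE va; rewrite m'E va addn0.
Qed.

(** At [r = 0] this is the Dirac mass at 0, because [0 ^+ 0 = 1], so rate 0 shares the formula of
    the positive rates. *)
Definition poisson_mass {R : realType} (r : R) (k : nat) : R :=
  r ^+ k / k`!%:R * expR (- r).

Lemma poisson_law1 (R : realType) (r : R) (k : nat) : 0 <= r ->
  poisson_law r [set k] = (poisson_mass r k)%:E.
Proof.
move=> r0; rewrite /poisson_law /poisson_prob; case: ifPn => [rgt0|].
  by rewrite esum_set1 ?lee_fin ?poisson_pmf_ge0// /poisson_pmf rgt0.
rewrite -leNgt => rle0; have -> : r = 0 by apply/eqP; rewrite eq_le rle0.
rewrite diracE /poisson_mass oppr0 expR0 mulr1; case: k => [|k].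
  by rewrite mem_set// expr0 fact0 divr1.
by rewrite memNset// expr0n mul0r.
Qed.

(* Given that their sum is [n], independent Poisson variables with equal rates
   are distributed as the occupation counts of [n] uniform choices. *)
Lemma poisson_multinomial (R : realType) (V : finType) (x : R) (n : nat)
    (E : pred {ffun V -> nat}) : (0 < #|V|)%N ->
  \sum_(m : {ffun V -> 'I_n.+1} |
          (\sum_v m v == n)%N && E [ffun v => nat_of_ord (m v)])
     \prod_v poisson_mass (x / #|V|%:R) (m v) =
  poisson_mass x n * \sum_(W : n.-tuple V | E (counts W)) #|V|%:R ^- n.
Proof.
move=> V0; have VN0 : #|V|%:R != 0 :> R by rewrite pnatr_eq0 -lt0n.
have cW (W : n.-tuple V) v : (count_mem v W < n.+1)%N.
  by rewrite ltnS -{2}(size_tuple W) count_size.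
(* The occupation profile of [W], with entries bounded by [n]: profiles then form a finite type
   along which the sum over [W] is partitioned. *)
pose p (W : n.-tuple V) : {ffun V -> 'I_n.+1} := [ffun v => Ordinal (cW W v)].
have pE W : [ffun v => nat_of_ord (p W v)] = counts W.
  by apply/ffunP => v; rewrite !ffunE.
rewrite (partition_big p
  (fun m => (\sum_v m v == n)%N && E [ffun v => nat_of_ord (m v)])) => /=;
    last first.
  move=> W EW; rewrite pE EW andbT -{4}(size_tuple W) -sum_counts.
  by apply/eqP/eq_bigr => v _; rewrite !ffunE.
rewrite big_distrr /=; apply: eq_bigr => m /andP[/eqP sm Em].
rewrite (eq_bigl (fun W : n.-tuple V => counts W == [ffun v =>
  nat_of_ord (m v)])); last first.
  move=> W; apply/andP/eqP => [[_ /eqP <-]|cm]; first by rewrite pE.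
  split; first by rewrite cm.
  by apply/eqP/ffunP => v; apply: val_inj; move/ffunP/(_ v): cm; rewrite !ffunE.
have sm' : (\sum_v [ffun v => nat_of_ord (m v)] v = n)%N.
  by rewrite -[RHS]sm; apply: eq_bigr => v _; rewrite ffunE.
have := sum_tuple_counts sm'.
rewrite -big_mkcond /= sum1_card sumr_const.
set N := #|_| => cE; rewrite -[_ ^- _ *+ N]mulr_natr.
have nE : n`!%:R = N%:R * \prod_v (m v)`!%:R :> R.
  rewrite -cE natrM natr_prod; congr (_ * _).
  by apply: eq_bigr => v _; rewrite ffunE.
(* The exponents add up to [n] and the [#|V|] exponentials multiply to [expR (- x)]; the multinomial
   identity turns the remaining factorials into [N / n!]. *)
rewrite {1}/poisson_mass !big_split/= prodrXr sm prodr_const prodfV.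
rewrite -expRM_natr mulNr divfK// exprMn exprVn /poisson_mass nE.
have N0 : N%:R != 0 :> R.
  rewrite pnatr_eq0; apply/eqP => N0; move/eqP: cE.
  by rewrite N0 mul0n eq_sym eqn0Ngt fact_gt0.
have P0 : \prod_v (m v)`!%:R != 0 :> R.
  by apply/prodf_neq0 => v _; rewrite pnatr_eq0 -lt0n fact_gt0.
by field; rewrite N0 P0 expf_neq0.
Qed.

(** * Sizes of trees of counts *)

Lemma suffix_cons_small (A : eqType) (a : A) (u v : seq A) :
  (size u <= size v)%N -> suffix u (a :: v) = suffix u v.
Proof. by move=> uv; rewrite !suffixE /= subSn. Qed.

(** [suffix u v] says that [v] descends from [u]. Induction on [p] replaces each word of depth [p]
    by its children; when [u] has the final depth, it is its own only descendant. Values in an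
    [nmodType] serve both item numbers and extended-real counts. *)
Lemma additive_sum_suffix (M : nmodType) (A : finType)
    (z : seq A -> M) (p : nat) (u : seq A) :
  (forall v, (size v < p)%N -> z v = \sum_(a : A) z (a :: v)) ->
  (size u <= p)%N -> z u = \sum_(v : p.-tuple A | suffix u v) z v.
Proof.
elim: p u => [|p IH] u zD up.
  move: up; rewrite leqn0 size_eq0 => /eqP ->.
  by rewrite (big_pred1 [tuple])// => v; rewrite (tuple0 v) suffix0s/= eqxx.
move: up; rewrite leq_eqVlt => /orP[/eqP up|].
  rewrite (big_pred1 (Tuple (introT eqP up)))// => v.
  by rewrite suffixE size_tuple [X in (_ - X)%N]up subnn drop0 /= -val_eqE.
rewrite ltnS => up.
rewrite big_mkcond (big_tuple_cons _ _ (fun v =>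
  if suffix u v then z v else 0)).
rewrite (IH u) ?[in LHS]big_mkcond//=; last first.
  by move=> v vp; apply: zD; rewrite ltnS ltnW.
apply: eq_bigr => v _.
case: ifPn => uv.
  rewrite zD ?size_tuple//; apply: eq_bigr => a _.
  by rewrite suffix_cons_small ?size_tuple// uv.
rewrite big1// => a _.
by rewrite suffix_cons_small ?size_tuple// (negbTE uv).
Qed.

(** Finite additivity, in the shape needed to split an event over the values of a discrete
    variable. *)
Lemma measure_bigcup_fintype (d : measure_display) (T : measurableType d)
    (R : realType) (mu : {measure set T -> \bar R}) (I : finType)
    (E : pred I) (F : I -> set T) :
  (forall i, measurable (F i)) ->
  (forall i j w, F i w -> F j w -> i = j) ->
  mu [set w | exists2 i, E i & F i w] = (\sum_(i | E i) mu (F i))%E.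
Proof.
move=> mF dF.
suff H (s : seq I) : uniq s -> measurable [set w
  | exists2 i, E i && (i \in s) & F i w] /\
    mu [set w | exists2 i, E i && (i \in s) & F i w] =
      (\sum_(i <- s | E i) mu (F i))%E.
  have [_ <-] := H _ (index_enum_uniq I); congr (mu _); apply/seteqP.
  split=> w [i]; first by move=> Ei; exists i; rewrite // Ei mem_index_enum.
  by move=> /andP[Ei _]; exists i.
elim: s => [_|a s IH /= /andP[as_ us]].
  rewrite big_nil (_ : [set _ | _] = set0).
    by rewrite measure0; split => //; exact: measurable0.
  by apply/seteqP; split => // w [i]; rewrite andbF.
have [mG GE] := IH us; set G := [set w | _] in mG GE.
rewrite big_cons; case: ifPn => Ea.
  have -> : [set w | exists2 i, E i && (i \in a :: s) & F i w] = F a `|` G.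
    apply/seteqP; split=> w.
      move=> [i /andP[Ei]]; rewrite inE => /predU1P[->|si] Fi; [by left|right].
      by exists i; rewrite // Ei.
    move=> [Fa|[i /andP[Ei si] Fi]]; first by exists a; rewrite // Ea mem_head.
    by exists i; rewrite // Ei inE si orbT.
  split; first exact: measurableU.
  rewrite measureU//; first by congr (_ + _)%E; exact: GE.
  apply/seteqP; split => // w [Fa [i /andP[_ si] Fi]].
  by move: as_; rewrite (dF _ _ _ Fa Fi) si.
rewrite -GE (_ : [set w | _] = G)//; apply/seteqP; split=> w [i /andP[Ei]].
  rewrite inE => /predU1P[ia|si] Fi; first by move: Ea; rewrite -ia Ei.
  by exists i; rewrite // Ei.
by move=> si Fi; exists i; rewrite // Ei inE si orbT.
Qed.

Section tree_size.
Context {R : realType}.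
Variables Q D : nat.
Local Open Scope ereal_scope.
Implicit Types (z : seq 'I_Q -> \bar R) (p : nat).

(* [z v] is the number of items at [v]: a node is internal when it has at least
   [D] items, and every internal node contributes [Q] children. *)
Definition internal z (v : seq 'I_Q) : \bar R :=
  if D%:R%:E <= z v then 1 else 0.

Definition tree_size z : \bar R :=
  1 + Q%:R%:E * \sum_(0 <= p <oo) \sum_(v : p.-tuple 'I_Q) internal z v.

(** For counts that decrease down the tree, these are the nodes of depth at most [p], although [z]
    is read at depths below [p] only. *)
Definition tree_size_upto p z : \bar R :=
  1 + Q%:R%:E * \sum_(0 <= l < p) \sum_(v : l.-tuple 'I_Q) internal z v.

Definition suffix_count {p} (m : {ffun p.-tuple 'I_Q -> nat})
    (u : seq 'I_Q) : \bar R :=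
  (\sum_(v : p.-tuple 'I_Q | suffix u v) m v)%N%:R%:E.

Lemma internal_ge0 z v : 0 <= internal z v.
Proof. by rewrite /internal; case: ifP. Qed.

Lemma sum_internal_ge0 z p : 0 <= \sum_(v : p.-tuple 'I_Q) internal z v.
Proof. by apply: sume_ge0 => v _; exact: internal_ge0. Qed.

Lemma tree_size_upto_le z : {homo tree_size_upto ^~ z : p p' /
  (p <= p')%N >-> p <= p'}.
Proof.
move=> p p' pp'; rewrite leeD2l// lee_wpmul2l ?lee_fin//.
by apply: lee_sum_nneg_natr => // l _ _; exact: sum_internal_ge0.
Qed.

(** The truncations increase to [tree_size], so the limit exceeds [t] exactly when one of them does.
    The strict inequality matters: it makes the event an increasing union over [p]. *)
Lemma tree_size_gt z (t : \bar R) :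
  t < tree_size z <-> exists p, t < tree_size_upto p z.
Proof.
split=> [|[p]]; last first.
  move=> /lt_le_trans; apply; rewrite leeD2l// lee_wpmul2l ?lee_fin//.
  by apply: nneseries_lim_ge => l _ _; exact: sum_internal_ge0.
apply: contraPP => /forallNP tp; apply/negP; rewrite -leNgt.
have : tree_size_upto p z @[p --> \oo] --> tree_size z.
  apply: cvgeD; [|exact: cvg_cst|].
    by rewrite fin_num_adde_defr.
  apply: cvgeZl => //; apply: is_cvg_nneseries => l _ _.
  exact: sum_internal_ge0.
move=> cz; rewrite -(cvg_lim _ cz)//; apply: lime_le.
  by apply/cvg_ex; exists (tree_size z).
by apply: nearW => p; rewrite leNgt; apply/negP.
Qed.

Lemma eq_tree_size_upto p z z' :
  (forall v, (size v < p)%N -> z v = z' v) ->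
  tree_size_upto p z = tree_size_upto p z'.
Proof.
move=> zz'; congr (1 + _ * _); apply: eq_big_nat => l /andP[_ lp].
by apply: eq_bigr => v _; rewrite /internal zz'// size_tuple.
Qed.

Lemma measurable_tree_size (d : measure_display) (T : measurableType d)
    (z : T -> seq 'I_Q -> \bar R) :
  (forall v, measurable_fun setT (z^~ v)) ->
  measurable_fun setT (fun w => tree_size (z w)) /\
  forall p, measurable_fun setT (fun w => tree_size_upto p (z w)).
Proof.
move=> mz.
have mi l : measurable_fun setT
    (fun w => \sum_(v : l.-tuple 'I_Q) internal (z w) v).
  apply: emeasurable_sum => v; apply: measurable_fun_if => //.
  by apply: measurable_fun_lee.
split=> [|p]; apply: emeasurable_funD => //; apply: measurable_funeM.
  by apply: ge0_emeasurable_sum => // l w _ _; exact: sum_internal_ge0.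
exact: emeasurable_sum.
Qed.

End tree_size.

(** * The splitting algorithm *)

(** A sum of ones can be cut along a partition, which lets the nodes be counted level by level. *)
Lemma counting_esum (R : realType) (T : choiceType) (A : set T) :
  counting A = \esum_(i in A) (1 : \bar R)%E.
Proof.
have iterE k : iter k (+%E (1%:E : \bar R)) 0%E = k%:R%:E.
  by elim: k => //= k ->; rewrite -EFinD nat1r.
rewrite /counting; case: asboolP => [finA|infA].
  by rewrite esum_fset// fsbig_finite//= big_const_seq count_predT iterE.
apply/esym/eq_infty => r;
  have [B BA Br] := infinite_set_fset (Num.truncn r).+1 infA.
apply: esum_ge; exists [set` B]; first by split; [exact: finite_fset|].
rewrite fsbig_finite//= set_fsetK big_const_seq count_predT iterE.
by rewrite lee_fin (le_trans (ltW (truncnS_gt r)))// ler_nat.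
Qed.

Section positions.
Variables (Q : nat) (c : seq 'I_Q -> nat -> 'I_Q).
Implicit Types (n p i : nat) (u v s : seq 'I_Q).

(** The path of item [i] followed for [p] steps whatever the threshold, hence defined even below the
    leaf where the item stops. *)
Definition position p i : seq 'I_Q := iter p (fun v => c v i :: v) [::].

Lemma size_position p i : size (position p i) == p.
Proof. by elim: p => //= p /eqP ->. Qed.

Definition positions n p : n.-tuple (p.-tuple 'I_Q) :=
  [tuple of [seq Tuple (size_position p i) | i <- iota 0 n]].

Lemma items_position n v :
  items c n v = [seq i <- iota 0 n | position (size v) i == v].
Proof.
elim: v => [|q u IH] /=; first by rewrite filter_predT.
rewrite IH -filter_predI; apply: eq_filter => i /=.
by rewrite eqseq_cons; case: (position _ i =P u) => [->|]//; rewrite !andbF.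
Qed.

Lemma size_items_cons n u :
  size (items c n u) = (\sum_q size (items c n (q :: u)))%N.
Proof.
rewrite -(size_map (c u)) -sum_counts; apply: eq_bigr => q _.
by rewrite ffunE /= count_map size_filter.
Qed.

Lemma size_items n p (v : p.-tuple 'I_Q) :
  size (items c n v) = counts (positions n p) v.
Proof.
rewrite items_position size_tuple ffunE count_map size_filter.
by apply: eq_count => i /=; rewrite -val_eqE.
Qed.

(** The items of a node are among those of its parent, so reaching [D] at [u] forces it at all
    ancestors and makes [u] a node. *)
Lemma is_node_cons D n q u :
  is_node D c n (q :: u) = (D <= size (items c n u))%N.
Proof.
rewrite /=; case: leqP => [|_]; last by rewrite andbF.
rewrite andbT; elim: u => [//|q' u IH] /= Dq.
have Du : (D <= size (items c n u))%N.
  by rewrite (leq_trans Dq)// size_filter count_size.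
by rewrite IH.
Qed.

(** [drop l.+1 s] is the ancestor of [s] at which letter [l] is chosen. An event about a path thus
    becomes a conjunction of conditions on single choices, to which independence applies. *)
Lemma position_eq s i : position (size s) i = s <->
  forall l, (l < size s)%N -> c (drop l.+1 s) i :: drop l.+1 s = drop l s.
Proof.
split=> [|H].
  elim: s => [//|q u IH] /= [cq pu] [|l]; rewrite ?ltnS /= ?drop0.
    by move: cq; rewrite pu => ->.
  exact: IH.
elim: s H => [//|q u IH] H /=.
have {}IH : position (size u) i = u by apply: IH => l lu; exact: (H l.+1).
by rewrite IH -[RHS](H 0%N)//= drop0.
Qed.

Context {R : realType}.

(** Nodes are counted by depth: the root gives 1, and by [is_node_cons] each word [v] with at least
    [D] items gives [Q] nodes one level down. *)
Lemma nb_nodesE D n :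
  nb_nodes D R c n = tree_size D (fun v => (size (items c n v))%:R%:E).
Proof.
pose node_at p : set (seq 'I_Q) :=
  [set tval v | v in [set v : p.-tuple 'I_Q | is_node D c n v]].
have sumE p : \esum_(v in node_at p) (1 : \bar R)%E =
    (\sum_(v : p.-tuple 'I_Q) if is_node D c n v then 1 else 0)%E.
  rewrite esum_image; last by move=> u v _ _; exact: val_inj.
  rewrite esum_mkcond esum_fset; [|exact: finite_finset|by move=> v _;
    case: ifP].
  rewrite (_ : [set: _] = [set` index_enum (p.-tuple 'I_Q : finType)]).
    rewrite -fsbig_seq ?index_enum_uniq//; apply: eq_bigr => v _.
    by congr (if _ then _ else _); apply/idP/idP; rewrite inE.
  by apply/seteqP; split=> // v _ /=; exact: mem_index_enum.
rewrite /nb_nodes (_ : [set _ | _] = \bigcup_(p in setT) node_at p); last first.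
  apply/seteqP; split=> [v nv|v [p _ [u nu <-]]//].
  by exists (size v) => //; exists (in_tuple v).
rewrite counting_esum esum_bigcupT//; last first.
  by move=> p p' _ _ [_ [[u _ <-] [v _ /(congr1 size)]]]; rewrite !size_tuple.
rewrite -nneseries_esumT; last by move=> p; exact: esum_ge0.
under eq_eseriesr do rewrite sumE.
rewrite nneseries_recl//; last by move=> p _; apply: sume_ge0 => v _; case: ifP.
congr (_ + _)%E.
  by rewrite (big_pred1 [tuple])// => v; rewrite (tuple0 v) /= eqxx.
rewrite -nneseries_addn; last by move=> p; apply: sume_ge0 => v _; case: ifP.
rewrite -nneseriesZl; last by move=> p _; exact: sum_internal_ge0.
apply: eq_eseriesr => p _; rewrite addn1.
rewrite (big_tuple_cons _ _ (fun v => if is_node D c n v then 1 else 0)%E).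
rewrite ge0_sume_distrr; last by move=> v _; exact: internal_ge0.
apply: eq_bigr => v _; under eq_bigr do rewrite is_node_cons.
rewrite /internal lee_fin ler_nat; case: ifP => _; last by rewrite big1// mule0.
rewrite big_const card_ord mule1.
by elim: Q => //= k ->; rewrite -EFinD nat1r.
Qed.

Lemma tree_size_upto_items D n p :
  tree_size_upto D p (fun v => (size (items c n v))%:R%:E : \bar R) =
  tree_size_upto D p (suffix_count (counts (positions n p))).
Proof.
apply: eq_tree_size_upto => v vp; congr (_%:R%:E).
rewrite (@additive_sum_suffix nat _ (fun v => size (items c n v)) p v)//.
- by apply: eq_bigr => u _; exact: size_items.
- by move=> u _; exact: size_items_cons.
exact: ltnW.
Qed.

End positions.

(** * Law of the paths under uniform choices *)

Section uniform_positions.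
Context {R : realType} {d : measure_display} {T : measurableType d}.
Variables (P : probability T R) (Q : nat).
Variables (c : seq 'I_Q -> nat -> T -> 'I_Q).
Hypothesis q0 : 'I_Q.
Hypothesis hc : uniform_choices P c.

Let cw w v i := c v i w.

(** Fixing the paths of [n] items down to depth [p] prescribes [n * p] distinct choices, independent
    and each of probability [1 / Q]. *)
Lemma probability_positions n p (W : n.-tuple (p.-tuple 'I_Q)) :
  measurable [set w | positions (cw w) n p = W] /\
  P [set w | positions (cw w) n p = W] = ((Q ^ p)%:R ^- n)%:E.
Proof.
have [mc Pc indep] := hc.
pose s i : p.-tuple 'I_Q := nth [tuple of nseq p q0] W i.
(* The pairs (ancestor, item) whose choice is prescribed; letter [l] is chosen at the parent, hence
   [l.+1]. *)
pose J : {fset (seq 'I_Q * nat)} :=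
  seq_fset tt [seq (drop l.+1 (s i), i) | i <- iota 0 n, l <- iota 0 p].
(* A pair does not record the depth [l], so the prescribed letter is described as the one that
   prolongs the ancestor towards the target; on [J] this is a singleton. *)
pose B (ui : seq 'I_Q * nat) := [set q | suffix (q :: ui.1) (s ui.2)].
have suffE i l q : (l < p)%N ->
    suffix (q :: drop l.+1 (s i)) (s i) = (q == nth q0 (s i) l).
  move=> lp; rewrite suffixE /= size_drop size_tuple subnSK// subKn 1?ltnW//.
  by rewrite (drop_nth q0) ?size_tuple// eqseq_cons eqxx andbT eq_sym.
have JP u i : reflect (exists2 l, (l < p)%N & (i < n)%N /\ u =
  drop l.+1 (s i)) ((u, i) \in J).
  rewrite seq_fsetE; apply: (iffP allpairsP) => [[[k l]]|[l lp [kn ->]]].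
    by rewrite !mem_iota /= => -[kn lp [-> ->]]; exists l.
  by exists (i, l); rewrite !mem_iota.
have BE ui : ui \in J -> exists q, B ui = [set q].
  case: ui => u i /JP[l lp [_ ->]]; exists (nth q0 (s i) l).
  by apply/seteqP; split=> q; rewrite /B /= suffE// => /eqP.
(* The ancestors attached to one item have distinct lengths, so no pair is listed twice. *)
have cardJ : size J = (n * p)%N.
  rewrite (perm_size (seq_fset_perm _ _)) undup_id ?size_allpairs ?size_iota//.
  apply: allpairs_uniq; rewrite ?iota_uniq// => il il'.
  move=> /allpairsP[[i l] /= [_ + ->]] /allpairsP[[i' l'] /= [_ + ->]].
  rewrite !mem_iota /= !add0n => lp l'p [] /[swap] -> /(congr1 size).
  rewrite !size_drop !size_tuple => ll; congr (_, _).
  by apply: succn_inj; rewrite -(subKn lp) ll subKn.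
have -> : [set w | positions (cw w) n p = W] =
    \bigcap_(ui in [set` J]) ((fun ui => c ui.1 ui.2) ui @^-1` B ui).
  apply/seteqP; split=> [w /= pW [u i] /JP[l lp [kn ->]]|w cB].
    have pos : position (cw w) p i = s i.
      by rewrite /s -pW (nth_map 0%N) ?size_iota// nth_iota.
    rewrite /= /B /=.
    have := (position_eq (cw w) (s i) i).1; rewrite size_tuple => /(_ pos).
    by move=> /(_ l lp); rewrite /cw => ->; exact: suffix_drop.
  apply/eq_from_tnth => i; rewrite (tnth_nth [tuple of nseq p q0]).
  rewrite [RHS](tnth_nth [tuple of nseq p q0]) -/(s i).
  apply: val_inj; rewrite /= (nth_map 0%N) ?size_iota// nth_iota//= add0n.
  rewrite -[in LHS](size_tuple (s i)); apply/position_eq => l.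
  rewrite size_tuple => lp.
  have : (drop l.+1 (s i), nat_of_ord i) \in J by apply/JP; exists l.
  move=> /cB; rewrite /B /= suffE// => /eqP cE.
  by rewrite [RHS](drop_nth q0) ?size_tuple// -cE.
split.
  apply: fin_bigcap_measurable => [|ui /BE[q ->]];
    [exact: finite_fset|exact: mc].
rewrite indep//.
rewrite (eq_big_seq (fun=> (Q%:R^-1)%:E)); last first.
  by move=> ui /BE[q ->]; exact: Pc.
rewrite big_const_seq count_predT cardJ natrX -exprVn -exprVn -exprM mulnC.
by elim: (p * n)%N => [|k /= ->]; rewrite ?expr0// exprS EFinM.
Qed.
End uniform_positions.

Section algorithm_law.
Context {R : realType} {d : measure_display} {T : measurableType d}.
Variables (P : probability T R) (Q D : nat).
Variables (c : seq 'I_Q -> nat -> T -> 'I_Q).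
Hypothesis q0 : 'I_Q.
Hypothesis hc : uniform_choices P c.
Local Open Scope ereal_scope.

Definition items_at n w (v : seq 'I_Q) : \bar R :=
  (size (items (fun v i => c v i w) n v))%:R%:E.

Lemma costE n : cost R D c n = (fun w => tree_size D (items_at n w)).
Proof. by apply/funext => w; exact: nb_nodesE. Qed.

(** The count is a function of the positions at the depth of [v], which take finitely many values,
    each on a measurable event. *)
Lemma measurable_items_at n v : measurable_fun setT (items_at n ^~ v).
Proof.
move=> _ Y mY; rewrite setTI.
have -> : items_at n ^~ v @^-1` Y =
    \bigcup_(W in [set W : n.-tuple ((size v).-tuple 'I_Q)
      | Y (counts W (in_tuple v))%:R%:E])
      [set w | positions (fun v i => c v i w) n (size v) = W].
  apply/seteqP; split=> [w Yw|w [W YW pW]].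
    eexists; last by [].
    by rewrite /= -size_items.
  by rewrite /items_at /= -[v in items _ _ v]/(tval (in_tuple v)) size_items pW.
apply: fin_bigcup_measurable; first exact: finite_finset.
by move=> W _; have [] := probability_positions q0 hc W.
Qed.

Lemma probability_items_tree_size_upto n p (t : \bar R) :
  P [set w | t < tree_size_upto D p (items_at n w)] =
  (\sum_(W : n.-tuple (p.-tuple 'I_Q) |
      (t < tree_size_upto D p (suffix_count (counts W)))%E)
        (Q ^ p)%:R ^- n)%R%:E.
Proof.
rewrite (_ : [set _ | _] = [set w | exists2 W : n.-tuple (p.-tuple 'I_Q),
    t < tree_size_upto D p (suffix_count (counts W)) &
    [set w | positions (fun v i => c v i w) n p = W] w]); last first.
  apply/seteqP; split=> [w /=|w [W tW /= pW]];
    rewrite /items_at tree_size_upto_items.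
    by exists (positions (fun v i => c v i w) n p).
  by rewrite pW.
rewrite measure_bigcup_fintype; first last.
- by move=> W W' w /= <- <-.
- by move=> W; have [] := probability_positions q0 hc W.
rewrite -sumEFin; apply: eq_bigr => W _.
by have [] := probability_positions q0 hc W.
Qed.

Lemma measurable_items_tree_size n : measurable_fun setT (fun w =>
  tree_size D (items_at n w)).
Proof. by have [] := measurable_tree_size D (measurable_items_at n). Qed.

End algorithm_law.

(** * Comparison of the laws *)

Lemma measurable_gt (R : realType) (d : measure_display) (T : measurableType d)
    (f : T -> \bar R) (t : \bar R) :
  measurable_fun setT f -> measurable [set w | (t < f w)%E].
Proof.
by move=> mf; rewrite -[X in measurable X]setTI; exact: emeasurable_fun_o_infty.
Qed.

(** Open rays are stable under intersection and generate the Borel sets of the extended line, so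
    Dynkin's lemma applies. Each ray contains the point [+oo]. *)
Lemma eq_probability_gt (R : realType) (P1 P2 : probability (\bar R) R) :
  (forall t : R, P1 `]t%:E, +oo[%classic = P2 `]t%:E, +oo[%classic) ->
  forall A, measurable A -> P1 A = P2 A.
Proof.
move=> P12 A; rewrite (_ : measurable = emeasurable (@ocitv R))//.
rewrite ErealGenOInfty.measurableE => mA.
apply: (@dynkin_induction _ _ _ (fun A =>
  P1 A = P2 A) (ErealGenOInfty.measurableE R) _ _ _ _ _ A mA) => //.
- move=> _ _ [s ->] [t ->]; exists (Num.max s t); apply/seteqP.
  by split=> y /=; rewrite !in_itv/= !andbT EFin_max gt_max => /andP.
- by rewrite !probability_setT.
- by move=> _ [t ->]; exact: P12.
- by move=> S mS PS; rewrite !probability_setC// PS.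
move=> F mF tF PF; rewrite !measure_semi_bigcup//; last 2 first.
  exact: bigcupT_measurable.
  exact: bigcupT_measurable.
by apply: eq_eseriesr => n _; exact: PF.
Qed.

Lemma probabilityI1 (R : realType) (d : measure_display) (T : measurableType d)
    (P : probability T R) (A B : set T) :
  measurable A -> measurable B -> P B = 1%E -> P (A `&` B) = P A.
Proof.
move=> mA mB PB; apply/esym/(etrans (measureDI P mA mB)).
rewrite -[RHS]add0e; congr (_ + _)%E.
apply/eqP; rewrite -measure_le0 (@le_trans _ _ (P (~` B)))//.
  by rewrite le_measure ?inE//; [exact: measurableD|exact: measurableC].
by rewrite probability_setC// PB subee.
Qed.

(** * Transfer to an additive family of counts with independent Poisson levels *)

Section law_transfer.
Context {R : realType} {d : measure_display} {T : measurableType d}.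
Variables (P : probability T R) (Q D : nat).
Variables (c : seq 'I_Q -> nat -> T -> 'I_Q) (x : R).
Hypothesis q0 : 'I_Q.
Hypothesis hc : uniform_choices P c.
Context {d' : measure_display} {T' : measurableType d'}.
Variables (P' : probability T' R) (Z : T' -> seq 'I_Q -> \bar R).
Local Open Scope ereal_scope.

Hypothesis mZ : forall v, measurable_fun setT (Z^~ v).
Hypothesis Z_nat : forall w v, Z w v = +oo \/ exists k : nat, Z w v = k%:R%:E.
Hypothesis Z_additive : forall w v, Z w v = \sum_q Z w (q :: v).
(** Independence within a level and the Poisson law of each count, packed into one joint mass
    function. *)
Hypothesis Z_law : forall p (m : {ffun p.-tuple 'I_Q -> nat}),
  P' [set w | forall v : p.-tuple 'I_Q, Z w v = (m v)%:R%:E] =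
  (\prod_v poisson_mass (x / (Q ^ p)%:R) (m v))%R%:E.

Lemma suffix_countE p (m : {ffun p.-tuple 'I_Q -> nat}) w u :
  (forall v : p.-tuple 'I_Q, Z w v = (m v)%:R%:E) -> (size u <= p)%N ->
  Z w u = suffix_count m u.
Proof.
move=> Zm up; rewrite (@additive_sum_suffix _ _ (Z w) p)//.
by under eq_bigr do rewrite Zm; rewrite sumEFin -natr_sum.
Qed.

(** Both sides are sums over the counts at depth [p]: products of Poisson masses on the left,
    occupation counts of uniform positions on the right. [poisson_multinomial] equates them. *)
Lemma joint_law_tree_size_upto p n (t : \bar R) :
  P' [set w | Z w [::] = n%:R%:E /\ t < tree_size_upto D p (Z w)] =
  (poisson_mass x n)%:E * P [set w | t < tree_size_upto D p (items_at c n w)].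
Proof.
pose val_ffun (m : {ffun p.-tuple 'I_Q -> 'I_n.+1}) :=
  [ffun v => nat_of_ord (m v)].
rewrite (_ : [set _ | _] = [set w | exists2 m : {ffun p.-tuple 'I_Q -> 'I_n.+1},
    (\sum_v m v == n)%N &&
      (t < tree_size_upto D p (suffix_count (val_ffun m))) &
    [set w | forall v : p.-tuple 'I_Q, Z w v = (val_ffun m v)%:R%:E] w]);
      last first.
  apply/seteqP; split=> w /=.
    move=> [Zn tZ].
    have Z0 v : 0 <= Z w v by case: (Z_nat w v) => [->|[k ->]];
      rewrite ?leey ?lee_fin.
    have Zsum := @additive_sum_suffix _ _ (Z w) p [::] (fun v _ =>
      Z_additive w v) (leq0n p).
    (* A total of [n] bounds every count by [n], which excludes [+oo] and leaves finitely many
       profiles. *)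
    have Zk (v : p.-tuple 'I_Q) : exists k : 'I_n.+1, Z w (tval v) = k%:R%:E.
      have : Z w (tval v) <= n%:R%:E.
        rewrite -Zn Zsum (bigD1 v) ?suffix0s//= leeDl//.
        by apply: sume_ge0 => u _.
      case: (Z_nat w v) => [->|[k ->]]; first by rewrite leye_eq.
      rewrite lee_fin ler_nat => kn.
      by exists (inord k); rewrite inordK.
    have [f fE] := fin_all_exists Zk.
    have Zf v : Z w (tval v) = (val_ffun [ffun v => f v] v)%:R%:E.
      by rewrite !ffunE fE.
    exists [ffun v => f v] => //; apply/andP; split.
      have := suffix_countE (u := [::]) Zf (leq0n p).
      rewrite Zn => -[] /eqP; rewrite eqr_nat => /eqP nE; apply/eqP;
        rewrite [RHS]nE.
      by apply: eq_big => [v|v _]; rewrite ?suffix0s// !ffunE.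
    rewrite -(@eq_tree_size_upto _ _ _ _ (Z w))// => u up.
    exact/suffix_countE/ltnW.
  move=> [m /andP[/eqP sm tm] Zm]; split.
    rewrite (suffix_countE (u := [::]) Zm)// /suffix_count; congr (_%:R%:E).
    by rewrite -[RHS]sm; apply: eq_big => [v|v _]; rewrite ?suffix0s// !ffunE.
  rewrite (@eq_tree_size_upto _ _ _ _ _ (suffix_count (val_ffun m)))// => u up.
  exact/suffix_countE/ltnW.
rewrite measure_bigcup_fintype; first last.
- move=> m m' w /= Zm Zm'; apply/ffunP => v; apply: val_inj => /=.
  have := Zm v; rewrite Zm' => -[] /eqP; rewrite eqr_nat => /eqP.
  by rewrite !ffunE.
- move=> m; rewrite (_ : [set _ | _] = \bigcap_(v in [set: p.-tuple 'I_Q])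
    (Z ^~ v @^-1` [set (val_ffun m v)%:R%:E])).
    apply: fin_bigcap_measurable; first exact: finite_finset.
    by move=> v _; rewrite -[X in measurable X]setTI; exact: mZ.
  by apply/seteqP; split=> [w Zw v _|w Zw v]; exact: Zw.
rewrite (probability_items_tree_size_upto _ q0 hc) -EFinM.
have V0 : (0 < #|{: p.-tuple 'I_Q}|)%N.
  by rewrite card_tuple card_ord expn_gt0 (leq_ltn_trans _ (ltn_ord q0)).
have := @poisson_multinomial R (p.-tuple 'I_Q) x n
  (fun m => t < tree_size_upto D p (suffix_count m)) V0.
rewrite card_tuple card_ord => <-; rewrite -sumEFin.
apply: eq_bigr => m _; apply: (etrans (Z_law (val_ffun m))); congr (_%:E).
by apply: eq_bigr => v _; rewrite ffunE.
Qed.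

Let mF n : measurable [set w | Z w [::] = n%:R%:E].
Proof.
by rewrite -[X in measurable X]setTI; exact: (mZ [::] _ (emeasurable_set1 _)).
Qed.

(** Continuity from below in the truncation depth, in both models; the limits agree because the
    terms do. *)
Lemma joint_law_tree_size n (t : \bar R) :
  P' [set w | Z w [::] = n%:R%:E /\ t < tree_size D (Z w)] =
  (poisson_mass x n)%:E * P [set w | t < tree_size D (items_at c n w)].
Proof.
have [_ mZu] := measurable_tree_size D mZ.
have [_ mIu] := measurable_tree_size D (measurable_items_at q0 hc n).
pose F p := [set w | Z w [::] = n%:R%:E /\ t < tree_size_upto D p (Z w)].
pose G p := [set w | t < tree_size_upto D p (items_at c n w)].
have mFp p : measurable (F p).
  by apply: measurableI; [exact: mF|exact: measurable_gt].
have mGp p : measurable (G p) by exact: measurable_gt.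
have cF : P' (F p) @[p --> \oo] --> P' (\bigcup_p F p).
  apply: nondecreasing_cvg_mu => //; first exact: bigcupT_measurable.
  move=> p p' pp'; apply/subsetPset => w [Zn tw]; split=> //.
  exact: lt_le_trans (tree_size_upto_le _ _ pp').
have cG : P (G p) @[p --> \oo] --> P (\bigcup_p G p).
  apply: nondecreasing_cvg_mu => //; first exact: bigcupT_measurable.
  move=> p p' pp'; apply/subsetPset => w tw.
  exact: lt_le_trans (tree_size_upto_le _ _ pp').
have -> : [set w | Z w [::] = n%:R%:E /\ t < tree_size D (Z w)] = \bigcup_p F p.
  apply/seteqP; split=> [w [Zn /tree_size_gt[p tp]]|w [p _ [Zn tp]]];
    first by exists p.
  by split=> //; apply/tree_size_gt; exists p.
have -> : [set w | t < tree_size D (items_at c n w)] = \bigcup_p G p.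
  apply/seteqP; split=> [w /tree_size_gt[p tp]|w [p _ tp]]; first by exists p.
  by apply/tree_size_gt; exists p.
apply: cvg_unique cF _ => //.
rewrite /= (_ : (fun p => P' (F p)) = fun p => (poisson_mass x n)%:E * P (G p)).
  exact: cvgeZl.
by apply/funext => p; exact: joint_law_tree_size_upto.
Qed.

Hypothesis x_ge0 : (0 <= x)%R.

(** At depth 0 there is a single word, and [Z_law] makes the root count Poisson of mean [x]; its
    masses sum to 1. *)
Lemma root_count_finite : P' (\bigcup_n [set w | Z w [::] = n%:R%:E]) = 1.
Proof.
rewrite measure_semi_bigcup//; first last.
- exact: bigcupT_measurable.
- by move=> n n' _ _ [w /= [-> [/eqP]]]; rewrite eqr_nat => /eqP.
transitivity (\sum_(0 <= n <oo) poisson_prob x 0 [set n]).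
  apply: eq_eseriesr => n _; rewrite [RHS](poisson_law1 n x_ge0).
  have := @Z_law 0 [ffun=> n].
  rewrite (big_pred1 [tuple]); last by move=> v; rewrite (tuple0 v) /= eqxx.
  rewrite ffunE divr1 => <-; congr (P' _); apply/seteqP; split=> w /=.
    by move=> Zn v; rewrite (tuple0 v) ffunE.
  by move=> /(_ [tuple]); rewrite ffunE.
rewrite -measure_semi_bigcup//; last by move=> n n' _ _ [w /= [-> ->]].
by rewrite bigcup_imset1 image_id;
  exact: (@probability_setT _ _ _ (poisson_prob x 0)).
Qed.

(** Both events are split over the initial number of items: the value of [X] on one side, the root
    count on the other. Independence of [X] and the costs factors each term as in
    [joint_law_tree_size]. *)
Lemma eq_dist_poisson_transform (X : {RV P >-> nat}) :
  (forall U, distribution P X U = poisson_law x U) ->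
  independent_of_sequence P X (cost R D c) ->
  eq_dist P P' (poisson_transform R D c X) (fun w => tree_size D (Z w)).
Proof.
move=> hX hXR.
have mcost n : measurable_fun setT (cost R D c n).
  by rewrite costE; exact: (measurable_items_tree_size _ q0 hc).
have mX n : measurable (X @^-1` [set n]).
  by rewrite -[X in measurable X]setTI; exact: measurable_funP.
have mPT : measurable_fun setT (poisson_transform R D c X).
  move=> _ Y mY; rewrite setTI.
  rewrite (_ : _ @^-1` _ =
    \bigcup_n (X @^-1` [set n] `&` cost R D c n @^-1` Y)).
    apply: bigcupT_measurable => n; apply: measurableI => //.
    by rewrite -[X in measurable X]setTI; exact: mcost.
  apply/seteqP; split=> w; first by exists (X w).
  by move=> [n _ [/= <-]].
have mZT : measurable_fun setT (fun w => tree_size D (Z w)).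
  by have [] := measurable_tree_size D mZ.
split=> // A mA.
have gt_law (t : \bar R) : P [set w | t < poisson_transform R D c X w] =
    P' [set w | t < tree_size D (Z w)].
  rewrite (_ : [set w | t < poisson_transform R D c X w] =
      \bigcup_n (X @^-1` [set n] `&` [set w | t < cost R D c n w])); last first.
    apply/seteqP; split=> w; first by exists (X w).
    by move=> [n _ [/= <-]].
  rewrite measure_semi_bigcup; first last.
  - by apply: bigcupT_measurable => n; apply: measurableI => //;
    exact: measurable_gt.
  - by move=> n n' _ _ [w [[/= <- _] [<- _]]].
  - by move=> n; apply: measurableI => //; exact: measurable_gt.
  pose Z0 := \bigcup_n [set w | Z w [::] = n%:R%:E].
  have mZ0 : measurable Z0 by exact: bigcupT_measurable.
  have mt : measurable [set w | t < tree_size D (Z w)] by exact: measurable_gt.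
  transitivity (P' (\bigcup_n [set w | Z w [::] =
    n%:R%:E /\ t < tree_size D (Z w)])).
    rewrite measure_semi_bigcup; first last.
    - by apply: bigcupT_measurable => n; exact: (measurableI _ _ (mF n) mt).
    - by move=> n n' _ _ [w [[/= -> _] [[/eqP]]]]; rewrite eqr_nat => /eqP.
    - by move=> n; exact: (measurableI _ _ (mF n) mt).
    apply: eq_eseriesr => n _; apply/esym/(etrans (joint_law_tree_size n t)).
    have PX : P (X @^-1` [set n]) = (poisson_mass x n)%:E.
      by rewrite -poisson_law1//; exact: (hX [set n]).
    rewrite -PX (_ : [set w | t < tree_size D (items_at c n w)] =
                     [set w | t < cost R D c n w]) ?costE//; apply/esym/hXR.
      by exists [set n]; rewrite ?setTI.
    apply: sub_sigma_algebra; exists n => //; exists `]t, +oo[%classic.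
      exact: emeasurable_itv.
    by rewrite setTI preimage_itvoy costE.
  rewrite (_ : \bigcup_n _ = Z0 `&` [set w | t < tree_size D (Z w)]);
    last first.
    by rewrite /Z0 setI_bigcupl.
  (* The union over [n] misses only the outcomes with infinite root count, a null event. *)
  by rewrite setIC probabilityI1// root_count_finite.
pose Y : {mfun T >-> \bar R} := mfun_Sub (mem_set mPT).
pose Y' : {mfun T' >-> \bar R} := mfun_Sub (mem_set mZT).
apply: (@eq_probability_gt R (distribution P Y) (distribution P' Y')) mA => t.
have := gt_law t%:E; rewrite -!preimage_itvoy; exact.
Qed.

End law_transfer.

(** * Cells of the Poisson processes *)

Section cells.
Variable Q : nat.

(** The word read in base [Q], the latest choice being the lowest digit: the children of cell [k]
    are numbered [k * Q + q]. *)
Fixpoint code (v : seq 'I_Q) : nat :=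
  if v is q :: u then (code u * Q + q)%N else 0%N.

Lemma code_lt v : (code v < Q ^ size v)%N.
Proof.
elim: v => //= q u IH; rewrite expnSr.
rewrite (@leq_trans ((code u).+1 * Q))// ?leq_mul2r ?IH ?orbT//.
by rewrite mulSn addnC ltn_add2r.
Qed.

Lemma code_inj u v : size u = size v -> code u = code v -> u = v.
Proof.
elim: u v => [[]//|q u IH] [//|q' v] /= [uv] H.
have Q0 : (0 < Q)%N by exact: leq_ltn_trans (ltn_ord q).
have qq' : q = q'.
  apply/val_inj; have := congr1 (modn ^~ Q) H.
  by rewrite !modnMDl !modn_small.
rewrite qq' in H *; congr (_ :: _); apply: IH => //.
by move/addIn/eqP: H; rewrite eqn_pmul2r// => /eqP.
Qed.

Lemma sum_code (M : nmodType) (p : nat) (F : nat -> M) :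
  \sum_(k < (Q ^ p)%N) F k = \sum_(v : p.-tuple 'I_Q) F (code v).
Proof.
elim: p F => [|p IH] F.
  by rewrite expn0 big_ord1 (big_pred1 [tuple])// => v;
    rewrite (tuple0 v)/= eqxx.
rewrite (big_tuple_cons _ _ (fun v => F (code v))) /= expnSr.
rewrite -(IH (fun k => \sum_(q < Q) F (k * Q + q)%N)).
elim: (Q ^ p)%N => [|K IHK]; first by rewrite mul0n !big_ord0.
by rewrite big_ord_recr /= -IHK mulSn addnC big_split_ord.
Qed.

Context {R : realType} {d d' : measure_display} {T : measurableType d}
  {S : measurableType d'}.
Variables (P : probability T R) (mu : set S -> \bar R) (N : R.-ker T ~> S).
Hypothesis hN : poisson_process P mu N.
Variables (x : R) (C : nat -> nat -> set S).
Hypothesis x_ge0 : 0 <= x.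
Hypothesis mC : forall p k, measurable (C p k).
Hypothesis muC : forall p k, (k < Q ^ p)%N -> mu (C p k) = (x / (Q ^ p)%:R)%:E.
Hypothesis C_disjoint : forall p k k' s, C p k s -> C p k' s -> k = k'.
Hypothesis C_split : forall p k,
  C p k = [set s | exists2 q, (q < Q)%N & C p.+1 (k * Q + q)%N s].

Definition cell_count w v : \bar R := N w (C (size v) (code v)).

Lemma measurable_cell_count v : measurable_fun setT (cell_count ^~ v).
Proof. exact: measurable_kernel. Qed.

Lemma cell_count_nat w v :
  cell_count w v = +oo%E \/ exists k : nat, cell_count w v = k%:R%:E.
Proof. by have [pN _ _ _] := hN; exact: pN. Qed.

Lemma cell_count_additive w v :
  cell_count w v = (\sum_q cell_count w (q :: v))%R.
Proof.
rewrite /cell_count C_split.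
rewrite -(@measure_bigcup_fintype _ _ _ (N w) _ predT
   (fun q : 'I_Q => C (size v).+1 (code v * Q + q)))//.
  congr (N w _); apply/seteqP; split=> s [q]; last by exists q.
  by move=> qQ Cs; exists (Ordinal qQ).
by move=> i j s Ci Cj; apply: val_inj;
  apply/(@addnI (code v * Q))/(C_disjoint Ci Cj).
Qed.

(** The [Q ^ p] cells of a level are disjoint and have equal mass, so a Poisson process gives them
    independent Poisson counts. *)
Lemma cell_count_law p (m : {ffun p.-tuple 'I_Q -> nat}) :
  P [set w | forall v : p.-tuple 'I_Q, cell_count w v = (m v)%:R%:E] =
  (\prod_v poisson_mass (x / (Q ^ p)%:R) (m v))%R%:E.
Proof.
have [_ lawN _ indN] := hN.
pose V := {: p.-tuple 'I_Q}.
(* Independence is stated for families indexed by ordinals, so the words are enumerated; [J] takes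
   all of them. *)
pose A (i : 'I_#|V|) := C p (code (enum_val i)).
pose J : {fset 'I_#|V|} := seq_fset tt (enum 'I_#|V|).
pose B (i : 'I_#|V|) : set (\bar R) := [set (m (enum_val i))%:R%:E].
have Jall i : i \in J by rewrite seq_fsetE mem_enum.
have tA : trivIset setT A.
  move=> i j _ _ [s [Ai Aj]]; apply: enum_val_inj; apply: val_inj.
  by apply: code_inj; [rewrite !size_tuple|exact: C_disjoint Ai Aj].
have := indN _ A (fun i => mC _ _) tA J B (fun i _ => emeasurable_set1 _).
rewrite (_ : \bigcap_(i in _) _ =
   [set w | forall v : p.-tuple 'I_Q, cell_count w v = (m v)%:R%:E]);
     last first.
  apply/seteqP; split=> w Hw.
    move=> v; have := Hw (enum_rank v) (Jall _).
    by rewrite /A /B /= enum_rankK /cell_count size_tuple.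
  by move=> i _; have := Hw (enum_val i); rewrite /cell_count size_tuple.
move=> ->.
rewrite (perm_big (enum 'I_#|V|)); last first.
  by apply: (perm_trans (seq_fset_perm _ _)); rewrite undup_id ?enum_uniq.
rewrite big_enum /= (big_morph EFin (@EFinM R) erefl).
rewrite [RHS](reindex _ (onW_bij _ (enum_val_bij _))) /=.
apply: eq_bigr => i _.
have Qi : (code (enum_val i) < Q ^ p)%N.
  by rewrite -[X in (_ ^ X)%N](size_tuple (enum_val i)) code_lt.
rewrite [LHS](lawN (A i) (m (enum_val i))); [|exact: mC|by rewrite muC// ltry].
by rewrite muC//= poisson_law1// divr_ge0.
Qed.

End cells.

(** Consecutive half-open intervals leave no gap. Monotonicity is weak, so that empty pieces are
    allowed and [x = 0] is covered. *)
Lemma itvoc_split (R : realDomainType) (b : nat -> R) (n : nat) :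
  {homo b : i j / (i <= j)%N >-> i <= j} ->
  `]b 0%N, b n]%classic =
    [set s | exists2 q, (q < n)%N & `]b q, b q.+1]%classic s].
Proof.
move=> b_mono; apply/seteqP; split=> s /=; last first.
  move=> [q qn]; rewrite !in_itv/= => /andP[bs sb].
  by rewrite (le_lt_trans (b_mono _ _ (leq0n q)))// (le_trans sb)//;
    exact: b_mono.
elim: n => [|n IH]; rewrite in_itv/= => /andP[b0 sb].
  by have := lt_le_trans b0 sb; rewrite ltxx.
have [sn|ns] := leP s (b n).
  have [|q qn bq] := IH; first by rewrite in_itv/= b0.
  by exists q => //; rewrite ltnS ltnW.
by exists n => //; rewrite in_itv/= ns.
Qed.

(** * Half-open intervals of the [Q]-adic subdivision *)

Section interval_cells.
Context {R : realType}.
Variables (Q : nat) (y : R).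
Hypothesis Q_gt0 : (0 < Q)%N.
Hypothesis y_ge0 : 0 <= y.

Definition itv_cell p k : set R :=
  `](y * k%:R / Q%:R ^+ p), (y * k.+1%:R / Q%:R ^+ p)]%classic.

Let Qp p : 0 < Q%:R ^+ p :> R.
Proof. by rewrite exprn_gt0// ltr0n. Qed.

Lemma itv_cell_disjoint p k k' s : itv_cell p k s -> itv_cell p k' s -> k = k'.
Proof.
have H i j : itv_cell p i s -> itv_cell p j s -> (i <= j)%N.
  rewrite /itv_cell /= !in_itv/= => /andP[is_ _] /andP[_ sj].
  have := lt_le_trans is_ sj; rewrite ltr_pM2r ?invr_gt0// => ij.
  rewrite -ltnS -(ltr_nat R) ltNge; apply/negP => ji.
  by move: ij; rewrite ltNge ler_wpM2l.
by move=> ks k's; apply/eqP; rewrite eqn_leq !H.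
Qed.

Lemma itv_cell_split p k :
  itv_cell p k = [set s | exists2 q, (q < Q)%N & itv_cell p.+1 (k * Q + q)%N s].
Proof.
have Q0 : Q%:R != 0 :> R by rewrite pnatr_eq0 -lt0n.
(* The cut points, multiples of [y / Q ^ p.+1], from the left end of the cell at [q = 0] to its
   right end at [q = Q]. *)
pose b q := y * (k * Q + q)%:R / Q%:R ^+ p.+1.
have -> : [set s | exists2 q, (q < Q)%N & itv_cell p.+1 (k * Q + q)%N s] =
    [set s | exists2 q, (q < Q)%N & `]b q, b q.+1]%classic s].
  have bE q : itv_cell p.+1 (k * Q + q)%N = `]b q, b q.+1]%classic.
    by rewrite /itv_cell /b addnS.
  by apply/seteqP; split=> s [q qQ]; [rewrite bE|rewrite -bE]; exists q.
rewrite -itvoc_split /b /itv_cell; last first.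
  move=> i j ij; rewrite ler_wpM2r ?invr_ge0 ?(ltW (Qp _))//.
  by rewrite ler_wpM2l// ler_nat leq_add2l.
have E (a : R) : y * (a * Q%:R) / Q%:R ^+ p.+1 = y * a / Q%:R ^+ p.
  by rewrite exprSr; field; rewrite Q0 expf_neq0.
by rewrite addn0 addnC -mulSn !natrM !E.
Qed.

Lemma lebesgue_itv_cell p k :
  lebesgue_measure (itv_cell p k) = (y / Q%:R ^+ p)%:E.
Proof.
rewrite lebesgue_measure_itv /= lte_fin.
have E : y * k.+1%:R / Q%:R ^+ p - y * k%:R / Q%:R ^+ p = y / Q%:R ^+ p.
  by rewrite -mulrBl -mulrBr -natrB ?leqnSn// subSnn mulr1.
(* If the ends are not in strict order the cell is empty, and [y >= 0] forces the length [y / Q ^ p]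
   to be 0. *)
case: ltP => [_|le]; first by rewrite -EFinD E.
apply/eqP; rewrite eqe eq_le divr_ge0 ?(ltW (Qp _))//=.
by rewrite -E subr_le0.
Qed.

End interval_cells.

(** * Application to the half-line and to the strip *)

Theorem proposition13 (R : realType) (Q D : nat) (hQ : (2 <= Q)%N)
  (hD : (2 <= D)%N)
  (d : measure_display) (T : measurableType d) (P : probability T R)
  (c : seq 'I_Q -> nat -> T -> 'I_Q) (hc : uniform_choices P c)
  (d1 : measure_display) (T1 : measurableType d1) (P1 : probability T1 R)
  (N : R.-ker T1 ~> R)
  (hN : poisson_process P1 lebesgue_Rplus N)
  (d2 : measure_display) (T2 : measurableType d2) (P2 : probability T2 R)
  (M : R.-ker T2 ~> (R * R)%type)
  (hM : poisson_process P2 lebesgue_strip M)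
  (x : R) (hx : 0 <= x)
  (X : {RV P >-> nat})
  (hX : forall U : set nat, distribution P X U = poisson_law x U)
  (hXR : independent_of_sequence P X (cost R D c)) :
  eq_dist P P1 (poisson_transform R D c X) (R1 Q D N x) /\
  eq_dist P P2 (poisson_transform R D c X) (R2 Q D M x).
Proof.
have Q0 : (0 < Q)%N by exact: leq_trans hQ.
pose q0 : 'I_Q := Ordinal Q0.
have Qp0 p : 0 < (Q ^ p)%:R :> R by rewrite ltr0n expn_gt0 Q0.
split.
- pose C := itv_cell Q x.
  have mC p k : measurable (C p k) by exact: measurable_itv.
  have muC p k : (k < Q ^ p)%N -> lebesgue_Rplus (C p k) = (x / (Q ^ p)%:R)%:E.
    (* The cells lie in the nonnegative half-line, so restricting Lebesgue measure does not change
       their mass. *)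
    move=> _; rewrite /lebesgue_Rplus /mrestr setIidl ?natrX
      ?lebesgue_itv_cell//.
    move=> s; rewrite /C /itv_cell /= !in_itv/= andbT => /andP[+ _].
    by move=> /ltW; apply: le_trans; rewrite divr_ge0 ?mulr_ge0// exprn_ge0.
  have -> : R1 Q D N x = (fun w => @tree_size R Q D (cell_count N C w)).
    apply/funext => w; congr (1 + _ * _)%E; apply: eq_eseriesr => p _.
    rewrite (sum_code Q p (fun k =>
      phi D (N w) (x * k%:R / Q%:R ^+ p) (x * k.+1%:R / Q%:R ^+ p))).
    by apply: eq_bigr => v _; rewrite /internal /cell_count size_tuple.
  apply: (eq_dist_poisson_transform q0 hc _ _ _ _ hx hX hXR).
  + by move=> v; exact: measurable_cell_count.
  + by move=> w v; exact: (cell_count_nat hN).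
  + by apply: cell_count_additive => //;
    [exact: itv_cell_disjoint|exact: itv_cell_split].
  + by apply: (cell_count_law hN) => //; exact: itv_cell_disjoint.
(* The unit interval is subdivided, with [y = 1], and the height is [x]: the mass is again
   [x / Q ^ p]. *)
- pose C p k : set (R * R) := itv_cell Q 1 p k `*` `[0, x]%classic.
  have mC p k : measurable (C p k).
    by apply: measurableX; exact: measurable_itv.
  have muC p k : (k < Q ^ p)%N -> lebesgue_strip (C p k) = (x / (Q ^ p)%:R)%:E.
    move=> kQ; rewrite /lebesgue_strip /mrestr setIidl.
      rewrite product_measure1E; [|exact: measurable_itv|exact: measurable_itv].
      have x_len : lebesgue_measure `[0, x]%classic = x%:E.
        rewrite lebesgue_measure_itv/= lte_fin; case: ltP => [_|x0].
          by rewrite -EFinD subr0.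
        by congr EFin; apply/eqP; rewrite eq_le hx.
      transitivity (lebesgue_measure (itv_cell Q (1 : R) p k) *
                    lebesgue_measure `[0%R, x]%classic)%E => //.
      by rewrite lebesgue_itv_cell// x_len -EFinM mul1r mulrC natrX.
    (* The bound [k < Q ^ p] keeps the cell inside the strip. *)
    move=> [s t] [/=]; rewrite /itv_cell /= !in_itv/= !mul1r =>
      /andP[ks sk] /andP[-> _].
    rewrite -natrX in ks sk; split=> //; apply/andP; split.
      by apply: le_trans (ltW ks); rewrite divr_ge0.
    by apply: (le_trans sk); rewrite ler_pdivrMr// mul1r ler_nat.
  have C_disjoint p k k' s : C p k s -> C p k' s -> k = k'.
    by move=> [Cs _] [Cs' _]; exact: itv_cell_disjoint Cs Cs'.
  have C_split p k : C p k =
    [set s | exists2 q, (q < Q)%N & C p.+1 (k * Q + q)%N s].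
    rewrite {1}/C itv_cell_split//; apply/seteqP; split=> -[s t] /=.
      by move=> [[q qQ Cs] Ct]; exists q.
    by move=> [q qQ [Cs Ct]]; split=> //; exists q.
  have -> : R2 Q D M x = (fun w => @tree_size R Q D (cell_count M C w)).
    apply/funext => w; congr (1 + _ * _)%E; apply: eq_eseriesr => p _.
    rewrite (sum_code Q p (fun k =>
      if (D%:R%:E <= M w (`](k%:R / Q%:R ^+ p)%R, (k.+1%:R / Q%:R ^+ p)%R]
                          `*` `[0%R, x]))%E then 1%E else 0%E)).
    apply: eq_bigr => v _; rewrite /internal /cell_count size_tuple.
    by rewrite /C /itv_cell !mul1r.
  apply: (eq_dist_poisson_transform q0 hc _ _ _ _ hx hX hXR).
  + by move=> v; exact: measurable_cell_count.
  + by move=> w v; exact: (cell_count_nat hM).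
  + exact: cell_count_additive.
  + exact: (cell_count_law hM).
Qed.
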